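(* Let $m,k$ be integers with $1\le k\le m-1$, and put $q=2^m$, $Q=2^k$, $g=\gcd(m,k)$. Assume that $m/g$ is odd (equivalently, that $\gcd(Q+1,q-1)=1$). Let $f$ be a polynomial of the form \[ f(x)=c_0x^{Q+1}+c_1x^{Q+q}+c_2x^{qQ+1}+c_3x^{q(Q+1)},\qquad c_0,c_1,c_2,c_3\in\mathbb{F}_{q^2}. \] (i) If $k>1$, then $f$ is not a complete permutation polynomial of $\mathbb{F}_{q^2}$. (ii) If $k=1$, then $f$ is a complete permutation polynomial of $\mathbb{F}_{q^2}$ if and only if $m$ is odd and there exist $\mathbb{F}_q$-linear permutations $L_1,L_2$ of $\mathbb{F}_{q^2}$ and an element $\gamma\in\mathbb{F}_{q^2}^*$ with $\operatorname{ord}(\gamma^{q-1})=3$ such that, as maps on $\mathbb{F}_{q^2}$, \[ f=L_1\circ C\circ L_2,\qquad f+\mathrm{id}=L_1\circ(C+\gamma\,\mathrm{id})\circ L_2, \] where $C(x)=x^{q+2}$ and $\mathrm{id}$ is the identity map of $\mathbb{F}_{q^2}$ (the same $L_1,L_2$ are used in both identities).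
   Context: A polynomial $f\in\mathbb{F}_{q^2}[x]$ is a permutation polynomial of $\mathbb{F}_{q^2}$ if the map $\alpha\mapsto f(\alpha)$ is a bijection of $\mathbb{F}_{q^2}$. It is a complete permutation polynomial (CPP) if both $f(x)$ and $f(x)+x$ are permutation polynomials of $\mathbb{F}_{q^2}$. The coefficients $c_i$ are arbitrary elements of $\mathbb{F}_{q^2}$ (they are not required to be nonzero). $\operatorname{ord}$ denotes multiplicative order in $\mathbb{F}_{q^2}^*$. *)

(* Defs.v *)
From HB Require Import structures.
From mathcomp Require Import all_boot all_order all_algebra all_fingroup.
Set Implicit Arguments. Unset Strict Implicit. Unset Printing Implicit Defensive.
Import GRing.Theory.
Local Open Scope ring_scope.

Definition perm_poly (F : finFieldType) (f : {poly F}) : Prop :=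
  bijective (fun a : F => f.[a]).

Definition complete_perm_poly (F : finFieldType) (f : {poly F}) : Prop :=
  perm_poly f /\ perm_poly (f + 'X).

(* When #|F| = q ^ 2, the subfield F_q of F is the set of roots of X^q - X. *)
Definition base_field (F : finFieldType) (q : nat) : {pred F} :=
  [pred a | a ^+ q == a].

(* F carries no canonical module structure over its subfield F_q, so linearity
   is the condition of GRing.linear with the scalars restricted to F_q. *)
Definition Fq_linear (F : finFieldType) (q : nat) (L : F -> F) : Prop :=
  forall a : F, a \in base_field q ->
  forall x y : F, L (a * x + y) = a * L x + L y.

Definition quad_poly (F : finFieldType) (q Q : nat) (c0 c1 c2 c3 : F) : {poly F} :=
  c0 *: 'X^(Q + 1) + c1 *: 'X^(Q + q) + c2 *: 'X^(q * Q + 1)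
    + c3 *: 'X^(q * (Q + 1)).

(* Main.v *)
(* Write T(u) = u^q + u. By homogeneity under F_q, f is complete iff for every
   x <> 0 the additive map y |-> f(x+y) + f(y) takes no value in F_q x. In
   particular T(x^q f(x)) <> 0, and the map y |-> T(P(x) y^Q + R(x) y) obtained
   by polarizing T(x^q f) is not onto F_q. With Q' = 2^(m-k), the latter forces
   P(x)^Q' R(x) into F_q, since otherwise y |-> (T(P^(qQ') y), T(R y)) would be
   onto. Comparing coefficients of this identity along z = x^(q-1), where
   z^(q+1) = 1, yields algebraic relations between the c_i. For k > 1 they are
   contradictory; for k = 1 they say that f(x) = S(x) M(x) with M an F_q-linear
   map of projective order 3 and S a quadratic form invariant under M up to
   scalars, and diagonalizing M over F_{q^2} conjugates f to a multiple of
   x^(q+2). *)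
Require Import Defs.
From HB Require Import structures.
From mathcomp Require Import all_boot all_order all_algebra all_fingroup.
From mathcomp Require Import cyclic pgroup finfield zify.
From Stdlib Require Import Ring.
Set Implicit Arguments. Unset Strict Implicit. Unset Printing Implicit Defensive.
Import GRing.Theory.
Local Open Scope ring_scope.

(** * Ring identities decided modulo 2 *)

Section Char2.
Variables (F : finFieldType) (charF : 2 \in [pchar F]).

(* Declaring F as a ring with coefficients in bool makes the Stdlib tactic ring
   decide identities modulo 2; the aliases below give it syntactically rigid
   operations. *)
Definition addF (x y : F) : F := x + y.
Definition mulF (x y : F) : F := x * y.
Definition subF (x y : F) : F := x - y.
Definition oppF (x : F) : F := - x.
Definition zeroF : F := 0.
Definition oneF : F := 1.
Definition bool_in_F (b : bool) : F := if b then oneF else zeroF.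

Lemma F_ring_theory : ring_theory zeroF oneF addF mulF subF oppF eq.
Proof.
rewrite /zeroF /oneF /addF /mulF /subF /oppF.
split=> *; rewrite ?add0r ?mul1r ?mulrDl ?subrr ?addrA ?mulrA //.
- by rewrite addrC.
- by rewrite mulrC.
Qed.

Lemma F_ring_morph :
  ring_morph zeroF oneF addF mulF subF oppF eq
    false true xorb andb xorb id Bool.eqb bool_in_F.
Proof.
rewrite /zeroF /oneF /addF /mulF /subF /oppF.
split; rewrite /bool_in_F /zeroF /oneF //; try by case; case;
  rewrite /= ?(addr0, add0r, subr0, mulr1, mulr0, subrr, sub0r,
               addrr_pchar2 charF, oppr_pchar2 charF).
by case; rewrite /= ?oppr0 ?(oppr_pchar2 charF).
Qed.

Add Ring F_ring : F_ring_theory (morphism F_ring_morph).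

Ltac reify2 t :=
  lazymatch t with
  | @GRing.add _ ?x (@GRing.opp _ ?y) =>
      let x' := reify2 x in let y' := reify2 y in constr:(subF x' y')
  | @GRing.add _ ?x ?y =>
      let x' := reify2 x in let y' := reify2 y in constr:(addF x' y')
  | @GRing.mul _ ?x ?y =>
      let x' := reify2 x in let y' := reify2 y in constr:(mulF x' y')
  | @GRing.opp _ ?x => let x' := reify2 x in constr:(oppF x')
  | @GRing.exp _ ?x ?n =>
      let n' := eval cbv in n in
      lazymatch n' with
      | 0%N => constr:(oneF)
      | 1%N => reify2 x
      | S (S ?k) => let x' := reify2 x in
                let y' := reify2 (@GRing.exp F x (S k)) in constr:(mulF x' y')
      | _ => t
      end
  | @GRing.zero _ => constr:(zeroF)
  | @GRing.one _ => constr:(oneF)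
  | _ => t
  end.

Ltac char2_ring :=
  lazymatch goal with
  | |- @eq _ ?a ?b =>
    let a' := reify2 a in let b' := reify2 b in
    change (@eq F a' b'); ring
  end.

Lemma eq_of_add0 (x y : F) : x + y = 0 -> x = y.
Proof. by move/eqP; rewrite addr_eq0 (oppr_pchar2 charF) => /eqP. Qed.

Lemma add0_of_eq (x y : F) : x = y -> x + y = 0.
Proof. by move->; rewrite (addrr_pchar2 charF). Qed.

(** * Frobenius powers and roots of unity of order q + 1 *)

Definition frob n (x : F) : F := x ^+ (2 ^ n).

Lemma frobD n x y : frob n (x + y) = frob n x + frob n y.
Proof.
by rewrite /frob exprDn_pchar // pnatX (eq_pnat _ (pcharf_eq charF)) pnat_id.
Qed.

Lemma frobM n x y : frob n (x * y) = frob n x * frob n y.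
Proof. exact: exprMn. Qed.

Lemma frob0 n : frob n 0 = 0.
Proof. by rewrite /frob expr0n expn_eq0. Qed.

Lemma frob1 n : frob n 1 = 1.
Proof. exact: expr1n. Qed.

Lemma frobV n x : frob n x^-1 = (frob n x)^-1.
Proof. exact: exprVn. Qed.

Lemma frobX n x d : frob n (x ^+ d) = frob n x ^+ d.
Proof. by rewrite /frob exprAC. Qed.

Lemma frob_eq0 n x : (frob n x == 0) = (x == 0).
Proof. by rewrite /frob expf_eq0 expn_gt0. Qed.

Lemma frob_comp a b x : frob a (frob b x) = frob (b + a) x.
Proof. by rewrite /frob -exprM -expnD. Qed.

Lemma frobC a b x : frob a (frob b x) = frob b (frob a x).
Proof. by rewrite !frob_comp addnC. Qed.

(** In characteristic 2 a hypothesis [l = r] is the relation [l + r = 0]. Many goals [x = y] below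
    are proved by writing [x + y] as a combination of such relations, with the cofactors given to
    [lin_mul]; [char2_ring] checks the certificate. *)
Lemma lin_eq (x y z : F) : z = 0 -> x + y = z -> x = y.
Proof. by move=> -> /eq_of_add0. Qed.

Lemma lin_mul (k l r : F) : l = r -> k * (l + r) = 0.
Proof. by move/add0_of_eq->; rewrite mulr0. Qed.

Lemma lin_add (x y : F) : x = 0 -> y = 0 -> x + y = 0.
Proof. by move=> -> ->; rewrite addr0. Qed.

Lemma frob_sqr x : frob 1 x = x * x.
Proof. by rewrite /frob expr2. Qed.

Lemma frob_inj n : injective (frob n).
Proof.
move=> x y exy; apply: eq_of_add0; apply/eqP; rewrite -(frob_eq0 n) frobD exy.
by rewrite (addrr_pchar2 charF).
Qed.

Variable m : nat.
Hypothesis cardF : #|F| = ((2 ^ m) ^ 2)%N.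
Local Notation q := (2 ^ m)%N.
Local Notation bar := (frob m).

Lemma barK x : bar (bar x) = x.
Proof. by rewrite frob_comp addnn -muln2 -[RHS]expf_card cardF -expnM. Qed.

Lemma m_gt0 : (0 < m)%N.
Proof. by have := finNzRing_gt1 F; rewrite cardF; case: (m). Qed.

Lemma frob_surj n y : {x | frob n x = y}.
Proof.
(* The total exponent becomes m * 2n, a multiple of 2m, and [frob (2 * m)] is the identity. *)
exists (frob (m * (n * 2) - n) y); rewrite frob_comp subnK; last first.
  by have := m_gt0; nia.
rewrite mulnCA; elim: n => [|n IHn]; first by rewrite /frob expr1.
by rewrite mulSn addnC -frob_comp IHn muln2 -addnn -frob_comp barK.
Qed.

(** Since z = x^(q-1) satisfies z^(q+1) = 1, exponents reduce modulo q+1. If the reduced polynomial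
    [h] were nonzero, h(X^(q-1)) would have degree at most q(q-1) but q^2-1 roots. *)
Lemma mu_sparse_eq0 (s : seq (F * nat)) :
  (forall x, x != 0 -> \sum_(p <- s) p.1 * (x ^+ (q - 1)) ^+ p.2 = 0) ->
  forall i, (i <= q)%N -> \sum_(p <- s | (p.2 %% q.+1 == i)%N) p.1 = 0.
Proof.
move=> hs i le_i.
have q2 : (2 <= q)%N by rewrite -{1}(expn1 2) leq_exp2l // m_gt0.
pose h : {poly F} := \sum_(p <- s) p.1 *: 'X^(p.2 %% q.+1)%N.
have <- : h`_i = \sum_(p <- s | (p.2 %% q.+1)%N == i) p.1.
  rewrite coef_sum [RHS]big_mkcond; apply: eq_bigr => p _.
  by rewrite coefZ coefXn eq_sym; case: eqP; rewrite ?mulr1 ?mulr0.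
have size_h : (size h <= q.+1)%N.
  rewrite (leq_trans (size_sum _ _ _)) //; apply/bigmax_leqP_seq => p _ _.
  by rewrite (leq_trans (size_scale_leq _ _)) // size_polyXn ltn_mod.
have h_mu x : x != 0 -> h.[x ^+ (q - 1)] = 0.
  move=> nz_x; rewrite -(hs x nz_x) horner_sum; apply: eq_bigr => p _.
  rewrite hornerZ hornerXn {2}(divn_eq p.2 q.+1) exprD mulnC exprM.
  suff -> : (x ^+ (q - 1)) ^+ q.+1 = 1 by rewrite expr1n mul1r.
  apply: (mulfI nz_x); rewrite mulr1 -exprM -exprS -[RHS]expf_card cardF.
  congr (_ ^+ _); nia.
have sz1 : (1 < size ('X^(q - 1) : {poly F}))%N by rewrite size_polyXn; lia.
have [-> | nz_h] := eqVneq h 0; first by rewrite coef0.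
have nz : h \Po 'X^(q - 1) != 0 by rewrite comp_poly_eq0.
have /(max_poly_roots nz)/(_ (enum_uniq _)) :
    all (root (h \Po 'X^(q - 1))) (enum (predC1 (0 : F))).
  apply/allP => x; rewrite mem_enum !inE => nz_x.
  by rewrite rootE horner_comp hornerXn h_mu.
rewrite -cardE cardC1 cardF => /leq_trans/(_ (size_comp_poly_leq _ _)).
rewrite size_polyXn /= -mulnn => abs; exfalso.
move: abs size_h q2; move: (2 ^ m)%N (size h) => u v; nia.
Qed.

(** * The quadratic map f, its polarization, norms and cube roots of unity *)

Variables (k : nat) (c0 c1 c2 c3 : F).
Hypothesis hk : (0 < k < m)%N.
Local Notation fr := (frob k).
Local Notation fr' := (frob (m - k)).

Lemma fr'K x : fr (fr' x) = bar x.
Proof. by rewrite frob_comp subnK // ltnW //; case/andP: hk. Qed.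

Lemma frK' x : fr' (fr x) = bar x.
Proof. by rewrite frobC fr'K. Qed.

Definition quadF x := c0 * (fr x * x) + c1 * (fr x * bar x)
  + c2 * (fr (bar x) * x) + c3 * (fr (bar x) * bar x).
Local Notation f := quadF.

Lemma horner_quad_poly x : (quad_poly q (2 ^ k) c0 c1 c2 c3).[x] = f x.
Proof.
by rewrite /quad_poly !hornerE /quadF /frob !(exprD, exprM, expr1).
Qed.

Lemma quadF0 : f 0 = 0.
Proof. by rewrite /quadF !frob0 !mulr0 !addr0. Qed.

Lemma quadFZ l x : bar l = l -> f (l * x) = fr l * l * f x.
Proof. by move=> bl; rewrite /quadF !frobM bl; char2_ring. Qed.

(* The polarization of y |-> T(x^q f(y)) at x is T(P(x) y^Q + R(x) y). *)
Definition radP x := bar c3 * (x * x) + (c0 + bar c2) * (x * bar x)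
  + c1 * (bar x * bar x).
Definition radR x := bar c3 * (fr x * x) + c0 * (fr x * bar x)
  + bar c1 * (fr (bar x) * x) + c2 * (fr (bar x) * bar x).
Local Notation P := radP.
Local Notation R := radR.

Lemma bar_trace x : bar (x + bar x) = x + bar x.
Proof. by rewrite frobD barK addrC. Qed.

Lemma bar_norm x : bar (x * bar x) = x * bar x.
Proof. by rewrite frobM barK mulrC. Qed.

Lemma norm_eq0 x : (x * bar x == 0) = (x == 0).
Proof. by rewrite mulf_eq0 frob_eq0 orbb. Qed.

Lemma bar_div x w : x != 0 -> bar x * w + x * bar w = 0 ->
  exists2 v, bar v = v & w = v * x.
Proof.
move=> nz_x /eq_of_add0 e; exists (w / x); last by rewrite divfK.
rewrite frobM frobV; apply/eqP; rewrite eqr_div ?frob_eq0 //.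
by rewrite mulrC -e mulrC.
Qed.

Lemma modn_eqE e n i : (e < 2 * n)%N -> (i < n)%N ->
  (e %% n == i)%N = (e == i) || (e == n + i)%N.
Proof.
move=> e2 lt_in; have [lt_en | le_ne] := ltnP e n; first by rewrite modn_small //; lia.
by rewrite -{1}(subnK le_ne) modnDr modn_small; lia.
Qed.

(** Hilbert 90 for F over F_q; for w different from 1 a witness is w^q + 1. *)
Lemma norm1_bar w : w * bar w = 1 -> exists2 x, x != 0 & bar x = w * x.
Proof.
move=> w1; have [-> | w_neq1] := eqVneq w 1.
  by exists 1; rewrite ?oner_eq0 // frob1 mulr1.
exists (bar w + 1).
  apply: contra w_neq1 => /eqP/eq_of_add0 e.
  by rewrite -w1 e mulr1.
by rewrite frobD barK frob1 mulrDr w1 mulr1 addrC.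
Qed.

Lemma sum_zip_mask (s : seq F) (e : seq nat) (a : pred nat) :
  \sum_(p <- zip s e | a p.2) p.1 = foldr +%R 0 (mask (map a e) s).
Proof.
elim: s e => [|x s IHs] [|y e] /=; rewrite ?big_nil // big_cons IHs /=.
by case: (a y).
Qed.

Lemma sum_foldr_map (T : Type) (h : T -> F) (s : seq T) :
  \sum_(p <- s) h p = foldr +%R 0 (map h s).
Proof. by rewrite foldrE big_map. Qed.

(** For m odd, q is 2 modulo 3. *)
Lemma cube_root_conj w : odd m -> w * w + w + 1 = 0 -> bar w = w * w.
Proof.
move=> m_odd w0; have w3 : w ^+ 3 = 1.
  by apply: (lin_eq (lin_mul (w + 1) w0)); char2_ring.
rewrite -[w * w]/(w ^+ 2) /frob -(expr_mod _ w3); congr (_ ^+ _).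
have -> : (q = 4 ^ m./2 * 2)%N.
  by rewrite -{1}(odd_double_half m) m_odd expnS -mul2n expnM mulnC.
by rewrite -modnMml -modnXm exp1n.
Qed.

Lemma cube_root_exists : exists w : F, w * w + w + 1 = 0.
Proof.
have : (3 %| #|[set: {unit F}]|)%N.
  rewrite card_finField_unit cardF -expnM -subn1 mulnC expnM.
  by rewrite -eqn_mod_dvd ?expn_gt0 // -modnXm exp1n.
case/Cauchy => // u _ u3.
have u3' : val u ^+ 3 = 1 by rewrite -FinRing.val_unitX -u3 expg_order.
exists (val u).
have u1 : val u + 1 != 0.
  apply/eqP => /eq_of_add0 e; have : u = 1%g by apply: val_inj.
  by move=> eu; move: u3; rewrite eu order1.
apply: (mulfI u1); rewrite mulr0; apply: (lin_eq (lin_mul 1 u3')); char2_ring.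
Qed.

(* For m = 3 and k = 2, with letters X and X' = X^q: after clearing
   denominators everything is expressed in a = B B', b = A A' and
   s = A^3 + A'^3. If s <> 0 the hypotheses force a^3 + a b^2 + b^3 = 0
   and s^2 = b^3. *)
Lemma sporadic_identity (A A' B B' C C' : F) :
  A * A' != B * B' -> A != 0 -> A' != 0 -> B != 0 -> B' != 0 ->
  A^+2 * C = B'^+2 * B -> A'^+2 * C' = B^+2 * B' ->
  B^+2 * C + A^+2 * C' + A'^+2 * B + B'^+2 * A' = 0 ->
  B'^+2 * C' + A'^+2 * C + A^+2 * B' + B^+2 * A = 0 ->
  A^+3 + A'^+3 = B^+2 * C' + B'^+2 * C ->
  A * B^+6 + A' * B'^+6 + A^+4 * B'^+3 + A'^+4 * B^+3 = 0.
Proof.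
move=> ab nzA nzA' nzB nzB' e1 e1' e4 e4' e0.
pose a := B * B'; pose b := A * A'.
have ea : a = B * B' by []. have eb : b = A * A' by [].
have nza : a != 0 by rewrite mulf_neq0.
have nzb : b != 0 by rewrite mulf_neq0.
have nzab : a + b != 0.
  by apply: contraNneq ab => /eq_of_add0 e; apply/eqP; rewrite -ea -eb e.
(* Eliminating C and C' from the two trace relations expresses B^3 through D and B'^3 through D'. As
   D D' = b^7 a, dividing by D amounts to multiplying by D', so only a, b and powers of A^3, A'^3
   remain. *)
pose D := b^+2 * (a + b)^+2 + A^+6 * a; pose D' := b^+2 * (a + b)^+2 + A'^+6 * a.
have eD : B^+3 * D = b^+3 * A * a^+2.
  apply: (lin_eq (lin_add (lin_add (lin_mul (A^+2 * A'^+2 * B^+2 * A^+2) e4)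
    (lin_mul (B^+4 * A'^+2 * A^+2) e1)) (lin_mul (A^+6 * B^+2) e1'))).
  by rewrite /D ea eb; char2_ring.
have eD' : B'^+3 * D' = b^+3 * A' * a^+2.
  apply: (lin_eq (lin_add (lin_add (lin_mul (A^+2 * A'^+2 * B'^+2 * A'^+2) e4')
    (lin_mul (B'^+4 * A^+2 * A'^+2) e1')) (lin_mul (A'^+6 * B'^+2) e1))).
  by rewrite /D' ea eb; char2_ring.
have DD : D * D' = b^+7 * a.
  apply: (mulfI (expf_neq0 3 nza)).
  transitivity ((B^+3 * D) * (B'^+3 * D')); first by rewrite ea; char2_ring.
  by rewrite eD eD' eb; char2_ring.
pose s := A^+3 + A'^+3.
have es : s = A^+3 + A'^+3 by [].
have N : b^+2 * (a + b)^+3 + (a + b) * a * s^+2 + a * b^+4 = 0.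
  apply: (mulfI (mulf_neq0 nzab (expf_neq0 2 nzb))); rewrite mulr0.
  apply: (lin_eq (lin_mul 1 DD)).
  rewrite /D /D' es.
  move: (a) => a0; rewrite eb; char2_ring.
have S : b^+6 * s = a^+2 * (b^+2 * (a + b)^+2 + b^+3 * a) * s.
  have h1 : b^+4 * (A^+2 * B^+3) = a * (A^+3 * D').
    apply: (mulfI (mulf_neq0 (expf_neq0 3 nzb) nza)).
    transitivity (A^+2 * B^+3 * (b^+7 * a)); first by char2_ring.
    rewrite -DD; transitivity (A^+2 * (B^+3 * D) * D'); first by char2_ring.
    by rewrite eD; char2_ring.
  have h2 : b^+4 * (A'^+2 * B'^+3) = a * (A'^+3 * D).
    apply: (mulfI (mulf_neq0 (expf_neq0 3 nzb) nza)).
    transitivity (A'^+2 * B'^+3 * (b^+7 * a)); first by char2_ring.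
    rewrite -DD; transitivity (A'^+2 * (B'^+3 * D') * D); first by char2_ring.
    by rewrite eD'; char2_ring.
  have h3 : b^+2 * s = a * (A^+2 * B^+3) + a * (A'^+2 * B'^+3).
    apply: (lin_eq (lin_add (lin_add (lin_mul (b^+2) e0) (lin_mul (A^+2 * B^+2) e1'))
      (lin_mul (A'^+2 * B'^+2) e1))).
    by rewrite es ea eb; char2_ring.
  apply: (lin_eq (lin_add (lin_add (lin_mul a h1) (lin_mul a h2)) (lin_mul (b^+4) h3))).
  rewrite /D /D' es. move: (a) => a0; rewrite eb; char2_ring.
have s3 : A^+9 + A'^+9 = s^+3 + b^+3 * s by rewrite es eb; char2_ring.
have T : b^+8 * (A * B^+6 + A' * B'^+6 + A^+4 * B'^+3 + A'^+4 * B^+3)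
    = s * (a^+2 * b^+4 * (a + b)^+4 + a * b^+7 * (a + b)^+2)
      + (s^+3 + b^+3 * s) * (a^+4 * b^+3 + a^+2 * b^+5).
  have h1 : b^+8 * (A * B^+6) = a^+2 * A^+3 * D'^+2.
    apply: (mulfI (mulf_neq0 (expf_neq0 6 nzb) (expf_neq0 2 nza))).
    transitivity (A * B^+6 * (b^+7 * a)^+2); first by char2_ring.
    rewrite -DD; transitivity (A * (B^+3 * D)^+2 * D'^+2); first by char2_ring.
    by rewrite eD; char2_ring.
  have h2 : b^+8 * (A' * B'^+6) = a^+2 * A'^+3 * D^+2.
    apply: (mulfI (mulf_neq0 (expf_neq0 6 nzb) (expf_neq0 2 nza))).
    transitivity (A' * B'^+6 * (b^+7 * a)^+2); first by char2_ring.
    rewrite -DD; transitivity (A' * (B'^+3 * D')^+2 * D^+2); first by char2_ring.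
    by rewrite eD'; char2_ring.
  have h3 : b^+3 * (A^+4 * B'^+3) = a * A^+3 * D.
    apply: (mulfI (mulf_neq0 (expf_neq0 4 nzb) nza)).
    transitivity (A^+4 * B'^+3 * (b^+7 * a)); first by char2_ring.
    rewrite -DD; transitivity (A^+4 * (B'^+3 * D') * D); first by char2_ring.
    by rewrite eD' eb; char2_ring.
  have h4 : b^+3 * (A'^+4 * B^+3) = a * A'^+3 * D'.
    apply: (mulfI (mulf_neq0 (expf_neq0 4 nzb) nza)).
    transitivity (A'^+4 * B^+3 * (b^+7 * a)); first by char2_ring.
    rewrite -DD; transitivity (A'^+4 * (B^+3 * D) * D'); first by char2_ring.
    by rewrite eD eb; char2_ring.
  apply: (lin_eq (lin_add (lin_add (lin_mul 1 h1) (lin_mul 1 h2))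
     (lin_add (lin_mul (b^+5) h3) (lin_mul (b^+5) h4)))).
  rewrite -s3 /D /D' es. move: (a) => a0; rewrite eb; char2_ring.
apply: (mulfI (expf_neq0 8 nzb)); rewrite mulr0 T.
have [-> | nzs] := eqVneq s 0; first by char2_ring.
have {}S : (a + b) * (a^+3 + a * b^+2 + b^+3) = 0.
  apply: (mulfI (mulf_neq0 nzs (expf_neq0 2 nzb))); rewrite mulr0.
  by apply: (lin_eq (lin_mul 1 S)); char2_ring.
have M : a^+3 + a * b^+2 + b^+3 = 0.
  by apply: (mulfI nzab); rewrite mulr0.
have s2 : s^+2 + b^+3 = 0.
  apply: (mulfI (mulf_neq0 nzab nza)); rewrite mulr0.
  apply: (lin_eq (lin_add (lin_mul 1 N) (lin_mul (b^+2) M))); char2_ring.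
apply: (lin_eq (lin_add (lin_mul (s * a * b^+4 * (a + b)^+2) M)
  (lin_mul (s * (a^+4 * b^+3 + a^+2 * b^+5)) s2))); char2_ring.
Qed.

(** * Conditions forced by completeness *)

Section Complete.
Hypothesis f_inj : injective f.
Hypothesis fx_inj : injective (fun x => f x + x).

(* Homogeneity under F_q turns the injectivity of f(x) + x into that of
   f(x) + v x for all v in F_q. *)
Lemma quadF_diff x y v : x != 0 -> bar v = v -> f (x + y) + f y != v * x.
Proof.
move=> nz_x bv; apply: contra_neqN nz_x => /eqP e.
have [v0 | nz_v] := eqVneq v 0.
  move: e; rewrite v0 mul0r => /eq_of_add0/f_inj xy.
  by apply: (addIr y); rewrite add0r.
(* This l lies in F_q and l^Q = v^-1, so f(l z) + l z = v^-1 l (f(z) + v z) for all z. *)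
pose l := fr' v^-1.
have bl : bar l = l by rewrite /l frobC frobV bv.
have frl : fr l = v^-1 by rewrite fr'K frobV bv.
have nz_l : l != 0 by rewrite frob_eq0 invr_eq0.
have /fx_inj : f (l * (x + y)) + l * (x + y) = f (l * y) + l * y.
  apply: eq_of_add0; rewrite !quadFZ // frl.
  rewrite (_ : _ + _ = v^-1 * l * (f (x + y) + f y) + l * x); last by char2_ring.
  rewrite e (_ : _ + _ = v * v^-1 * (l * x) + l * x); last by char2_ring.
  by rewrite mulfV // mul1r (addrr_pchar2 charF).
by move/(mulfI nz_l)=> xy; apply: (addIr y); rewrite add0r.
Qed.

Lemma quadF_neq0 x : x != 0 -> f x != 0.
Proof. by move=> nz; rewrite -quadF0 (inj_eq f_inj). Qed.

Lemma quadF_trace x : x != 0 -> bar x * f x + x * bar (f x) != 0.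
Proof.
move=> nz; apply/eqP => /(bar_div nz)[v bv e].
by have := quadF_diff 0 nz bv; rewrite addr0 quadF0 addr0 e eqxx.
Qed.

(* Otherwise y |-> T(x^q (f(x+y) + f(x) + f(y))) = T(P(x) y^Q + R(x) y) maps
   F onto F_q, which makes f(x+y) + f(y) an F_q-multiple of x for some y. *)
Lemma radical_rational x : bar (fr' (P x) * R x) = fr' (P x) * R x.
Proof.
apply/esym/eq_of_add0/eqP/negPn/negP => nz.
have nz_x : x != 0.
  apply: contraNneq nz => ->.
  by rewrite /radP /radR !frob0 !(mulr0, addr0) frob0 addr0.
have [p frp bp] : exists2 p, fr p = P x & bar p = fr' (P x).
  by exists (fr' (bar (P x))); rewrite ?fr'K ?(frobC m (m - k)) barK.
pose N := bar x * f x + bar (bar x * f x).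
have [t bt RT] : exists2 t, bar t = t & (fr' (P x) * R x + bar (fr' (P x) * R x)) * t = N.
  exists (N / (fr' (P x) * R x + bar (fr' (P x) * R x))); last by rewrite mulrC divfK.
  by rewrite frobM frobV !bar_trace.
(* With t in F_q, P(x) y^Q is the Q-th power of an element of F_q and has trace 0, while T(R(x) y) =
   t T(P(x)^Q' R(x)) = N by the choice of t. *)
pose y := bar p * t.
have PY : P x * fr y + bar (P x * fr y) = 0.
  have -> : P x * fr y = fr (p * bar p * t) by rewrite /y !frobM frp; char2_ring.
  by apply: add0_of_eq; rewrite (frobC m k) !(frobM m) barK bt; congr fr; char2_ring.
have RY : R x * y + bar (R x * y) = N.
  by rewrite -RT /y !(frobM m) barK bt -bp barK; char2_ring.
have : bar x * (f (x + y) + f y) + x * bar (f (x + y) + f y) = 0.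
  rewrite (_ : _ + _ = N + (P x * fr y + bar (P x * fr y))
      + (R x * y + bar (R x * y))).
    by rewrite PY RY addr0 (addrr_pchar2 charF).
  clearbody y; rewrite /N /radP /radR /quadF !(frobD, frobM, frobC m k, barK).
  char2_ring.
case/(bar_div nz_x) => v bv e.
by have := quadF_diff y nz_x bv; rewrite e eqxx.
Qed.

(* Put z = x^(q-1), so that x^q = z x. Dividing the identity
   T(P(x)^Q' R(x)) = 0 by x^(2Q'+Q+1) gives a sum of terms c z^e, with c in
   mu_coefs and e in mu_exps; as z ranges over the (q+1)-st roots of unity,
   the exponents only matter modulo q + 1. *)
Definition mu_coefs : seq F :=
  let a0 := fr' (bar c3) in let a1 := fr' (c0 + bar c2) in let a2 := fr' c1 in
  let b0 := bar c3 in let b1 := c0 in let b2 := bar c1 in let b3 := c2 in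
  let a0' := fr' (bar c1) in let a1' := fr' (bar c0 + c2) in let a2' := fr' c3 in
  let b0' := bar c2 in let b1' := c1 in let b2' := bar c0 in let b3' := c3 in
  [:: a0 * b0 + a0' * b0'; a0 * b1 + a0' * b1';
      a0 * b2 + a0' * b2'; a0 * b3 + a0' * b3';
      a1 * b0 + a1' * b0'; a1 * b1 + a1' * b1';
      a1 * b2 + a1' * b2'; a1 * b3 + a1' * b3';
      a2 * b0 + a2' * b0'; a2 * b1 + a2' * b1';
      a2 * b2 + a2' * b2'; a2 * b3 + a2' * b3'].

Definition mu_exps (Q Q' : nat) : seq nat :=
  [:: 0; 1; Q; Q + 1; Q'; Q' + 1; Q' + Q; Q' + Q + 1;
      2 * Q'; 2 * Q' + 1; 2 * Q' + Q; 2 * Q' + Q + 1]%N.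

(* js lists the positions in mu_exps of the exponents congruent to i. *)
Lemma mu_coef i (js : seq nat) n Q Q' :
  q = n -> (2 ^ k)%N = Q -> (2 ^ (m - k))%N = Q' -> (i <= n)%N ->
  [seq e %% n.+1 == i | e <- mu_exps Q Q']%N = [seq j \in js | j <- iota 0 12]%N ->
  foldr +%R 0 (mask [seq j \in js | j <- iota 0 12]%N mu_coefs) = 0.
Proof.
move=> <- <- <- le_i <-; suff /mu_sparse_eq0/(_ i le_i) : forall x, x != 0 ->
    \sum_(p <- zip mu_coefs (mu_exps (2 ^ k) (2 ^ (m - k))))
      p.1 * (x ^+ (q - 1)) ^+ p.2 = 0.
  by move=> e0; rewrite -[RHS]e0; exact/esym/sum_zip_mask.
move=> x nz_x; rewrite /mu_coefs /mu_exps /= !big_cons big_nil /=.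
set z := x ^+ (q - 1).
have zx : bar x = z * x.
  by rewrite -exprSr subn1 prednK // expn_gt0.
have -> : z ^+ (2 ^ k) = fr z by [].
rewrite mulnC !exprD !exprM expr0 expr1.
have -> : z ^+ (2 ^ k) = fr z by [].
have -> : z ^+ (2 ^ (m - k)) = fr' z by [].
have nzX : fr x != 0 by rewrite frob_eq0.
have nzu : fr' x != 0 by rewrite frob_eq0.
apply: (mulIf (mulf_neq0 (mulf_neq0 nzu nzu) (mulf_neq0 nzX nz_x))).
have /esym/add0_of_eq := radical_rational x.
rewrite /radP /radR !(frobD, frobM, frobC m (m - k), frobC m k, barK) zx.
rewrite !(frobM k, frobM (m - k)) => e; rewrite mul0r -[RHS]e; char2_ring.
Qed.

(** * Relations between the coefficients *)

Hypothesis k_neq : k != (m - k)%N.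

(** With Q = 2u, Q' = 2v and q + 1 = 4w + 1, the coincidences modulo q + 1 among [mu_exps] are
    decided by linear arithmetic in each of the cases k = 1 and k > 1. *)
Lemma half_powers : exists u v w : nat,
  [/\ (2 ^ k = 2 * u)%N, (2 ^ (m - k) = 2 * v)%N, (q = 4 * w)%N, (0 < v)%N /\ u <> v &
    [/\ k = 1, u = 1, w = v & 1 < v]%N \/ [/\ 1 < k, 1 < u, w = u * v & 2 * v + u <= 2 * w]%N].
Proof.
case/andP: hk => k0 km.
have e1 : (2 ^ k = 2 * 2 ^ k.-1)%N by rewrite -expnS prednK.
have e2 : (2 ^ (m - k) = 2 * 2 ^ (m - k).-1)%N by rewrite -expnS prednK // subn_gt0.
exists (2 ^ k.-1)%N, (2 ^ (m - k).-1)%N, (2 ^ k.-1 * 2 ^ (m - k).-1)%N.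
have neq : (2 ^ k.-1)%N <> (2 ^ (m - k).-1)%N.
  by move=> e; move: k_neq; rewrite -(@eqn_exp2l 2) // e1 e2 e eqxx.
split=> //.
- rewrite -(subnK (ltnW km)) expnD e1 e2 addnK; lia.
- by rewrite expn_gt0.
have := expn_gt0 2 (m - k).-1; move: neq.
have [->|k1] := eqVneq k 1%N.
  by rewrite subn1 /= expn0 mul1n => *; left; split=> //; lia.
have : (1 < 2 ^ k.-1)%N by rewrite -{1}(expn0 2) ltn_exp2l //; lia.
move: (2 ^ k.-1)%N (2 ^ (m - k).-1)%N => u v *; right; split=> //; nia.
Qed.

Ltac mu_exps_tac :=
  rewrite /= ?inE ?modn_eqE; try lia; repeat (apply: (f_equal2 cons); [lia|]); reflexivity.
Ltac mu_coef_at i js eq_q eQ eQ' :=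
  have := @mu_coef i js _ _ _ eq_q eQ eQ' ltac:(lia) ltac:(mu_exps_tac);
  rewrite /= ?addr0.

Lemma fr'_cross : fr' (bar c0 + c2) = bar (fr' (c0 + bar c2)).
Proof. by rewrite (frobC m) (frobD m) barK. Qed.

(* Otherwise f(x) is divisible by w x + x^q for some w of norm 1, hence has a
   nontrivial zero. *)
Lemma c2_conj : bar c2 = c0.
Proof.
have [u [v [w [eQ eQ' eq_q [v_gt0 uv] cond]]]] := half_powers.
apply/esym/eq_of_add0/eqP/negPn/negP => nz.
have : fr' (c0 + bar c2) * c0 = bar (fr' (c0 + bar c2)) * c1.
  rewrite -fr'_cross; apply: eq_of_add0; case: cond => [[k1 u1 wv v1] | [k1 u1 _ uvw]];
  by mu_coef_at (2 * v + 1)%N [:: 5]%N eq_q eQ eQ'.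
have : fr' (c0 + bar c2) * bar c3 = bar (fr' (c0 + bar c2)) * bar c2.
  rewrite -fr'_cross; apply: eq_of_add0; case: cond => [[k1 u1 wv v1] | [k1 u1 _ uvw]];
  by mu_coef_at (2 * v)%N [:: 4]%N eq_q eQ eQ'.
have : fr' (c0 + bar c2) != 0 by rewrite frob_eq0.
move: (fr' _) => a nz_a e32 e01.
have nz_a' : bar a != 0 by rewrite frob_eq0.
have [x nz_x bx] : exists2 x, x != 0 & bar x = (bar a / a) * x.
  apply: norm1_bar; rewrite frobM frobV barK.
  by rewrite mulrA divfK ?mulfV.
have ax : a * bar x = bar a * x by rewrite bx mulrA mulrCA mulfV ?mulr1.
have ac : bar a * c3 = a * c2.
  by move/(congr1 bar): e32; rewrite !frobM !barK.
suff : a * bar a * f x == 0.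
  by rewrite !mulf_eq0 (negPf nz_a) (negPf nz_a') (negPf (quadF_neq0 nz_x)).
apply/eqP/(lin_eq (lin_add (lin_add (lin_mul (bar a * fr x * x) e01)
  (lin_mul (bar a * fr x * c1 + a * c2 * fr (bar x)) ax))
  (lin_mul (a * bar x * fr (bar x)) ac))).
by rewrite /quadF; char2_ring.
Qed.

(** Serves to show, with [quadF_trace], that P has no nontrivial zero. *)
Lemma trace_radP x :
  bar x * f x + x * bar (f x) = P x * fr x + bar (P x * fr x).
Proof.
rewrite /radP /quadF !(frobD, frobM, frobC m k, barK); char2_ring.
Qed.

(* Otherwise the binary form P has a nontrivial zero. *)
Lemma norms_neq : c3 * bar c3 != c1 * bar c1.
Proof.
apply/negP => /eqP e.
suff [x nz_x Px] : exists2 x, x != 0 & P x = 0.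
  by have := quadF_trace nz_x; rewrite trace_radP Px mul0r frob0 addr0 eqxx.
rewrite /radP c2_conj (addrr_pchar2 charF).
have [c10 | nz1] := eqVneq c1 0.
  exists 1; first exact: oner_neq0.
  move/eqP: e; rewrite c10 mul0r mulf_eq0 frob_eq0 orbb => /eqP ->.
  by rewrite frob0 !mul0r !addr0.
have [w ew] := frob_surj 1 (bar c3 / c1).
have [x nz_x bx] : exists2 x, x != 0 & bar x = w * x.
  apply: norm1_bar; apply: (@frob_inj 1).
  rewrite frobM frobC ew frobM barK frobV frob1 mulrACA -invfM.
  by rewrite (mulrC (bar c3)) e mulfV // norm_eq0.
have cw : c1 * (w * w) = bar c3 by rewrite -frob_sqr ew mulrC divfK.
by exists x => //; rewrite bx -cw; char2_ring.
Qed.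

(* For lambda in F_q with lambda^(Q+1) = 1, f (lambda x) = f x. *)
Lemma bar_expQ1_inj r s : bar r = r -> bar s = s -> s != 0 ->
  fr r * r = fr s * s -> r = s.
Proof.
move=> br bs nz_s e; have : f (r / s * 1) = f 1.
  rewrite quadFZ ?frobM ?frobV ?br ?bs //.
  by rewrite mulrACA e -invfM mulfV ?mul1r // mulf_neq0 // frob_eq0.
by move/f_inj; rewrite mulr1 => /(divr1_eq).
Qed.

(** * Exclusion of k > 1 *)

(** Norms of the relations at exponents 0 and 1 give n3^Q' n3 = n1^Q' n0 and n3^Q' n0 = n1^Q' n1.
    The relation at Q adds n3^Q' n1 = n1^Q' n0, whence n3 = n1. If Q = 2Q' two exponents collide
    there, but multiplying the first two gives n3^(Q+1) = n1^(Q+1). Either way [norms_neq] is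
    violated. *)
Lemma large_k_absurd : (1 < k)%N -> (3 < m)%N -> False.
Proof.
have [u [v [w [eQ eQ' eq_q [v_gt0 uv] [[-> //] | [_ u1 wuv uvw]]]]]] := half_powers.
(* Strictness keeps every exponent below q + 1, so none wraps around; equality occurs for m = 3, k =
   2. *)
move=> _ m3; have {}uvw : (2 * v + u < 2 * w)%N.
  have : (16 <= q)%N by rewrite -[16%N]/(2 ^ 4)%N leq_exp2l.
  rewrite eq_q wuv; have [v1 | v1] := ltnP 1 v; first by nia.
  have -> : v = 1%N by lia.
  lia.
have neq := norms_neq.
have e2 : u <> (2 * v)%N -> fr' (bar c3) * bar c1 = bar (fr' c1) * bar c0.
  move=> u2v; rewrite -(frobC (m - k)); apply: eq_of_add0.
  by mu_coef_at (2 * u)%N [:: 2]%N eq_q eQ eQ'.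
have e0 : fr' (bar c3) * bar c3 = bar (fr' c1) * c0.
  rewrite -c2_conj -(frobC (m - k)); apply: eq_of_add0.
  by mu_coef_at 0%N [:: 0]%N eq_q eQ eQ'.
have e1 : fr' (bar c3) * c0 = bar (fr' c1) * c1.
  rewrite -(frobC (m - k)); apply: eq_of_add0.
  by mu_coef_at 1%N [:: 1]%N eq_q eQ eQ'.
have nz3 : c3 != 0.
  apply: contraNneq neq => c30; move/esym/eqP: e1.
  rewrite c30 frob0 frob0 mul0r mulf_eq0 !frob_eq0 orbb => /eqP ->.
  by rewrite frob0 !mul0r.
have nz1 : c1 != 0.
  apply: contraNneq neq => c10; move/eqP: e0.
  rewrite c10 !frob0 mul0r mulf_eq0 !frob_eq0 orbb => /eqP ->.
  by rewrite !mul0r.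
move: neq; apply/negP/negPn/eqP.
set n3 := c3 * bar c3; set n1 := c1 * bar c1; set n0 := c0 * bar c0.
have bn3 : bar n3 = n3 by rewrite /n3 frobM barK mulrC.
have bn1 : bar n1 = n1 by rewrite /n1 frobM barK mulrC.
have nz_n3 : n3 != 0 by rewrite mulf_neq0 ?frob_eq0.
have nz_n1 : n1 != 0 by rewrite mulf_neq0 ?frob_eq0.
have nz_fn3 : fr' n3 != 0 by rewrite frob_eq0.
have nz_fn1 : fr' n1 != 0 by rewrite frob_eq0.
have N0 : fr' n3 * n3 = fr' n1 * n0.
  rewrite /n3 /n1 /n0 !(frobM (m - k)).
  transitivity (fr' (bar c3) * bar c3 * bar (fr' (bar c3) * bar c3)).
    by rewrite !frobM (frobC m (m - k)) barK; char2_ring.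
  by rewrite e0 frobM barK -(frobC (m - k)); char2_ring.
have N1 : fr' n3 * n0 = fr' n1 * n1.
  rewrite /n3 /n1 /n0 !(frobM (m - k)).
  transitivity (fr' (bar c3) * c0 * bar (fr' (bar c3) * c0)).
    by rewrite !frobM (frobC m (m - k)) barK; char2_ring.
  by rewrite e1 frobM barK -(frobC (m - k)); char2_ring.
have [u2v | u2v] := eqVneq u (2 * v)%N; last first.
  apply: (mulfI nz_fn3); rewrite N0.
  rewrite /n3 /n1 /n0 !(frobM (m - k)).
  transitivity (bar (fr' c1) * bar c0 * bar (bar (fr' c1) * bar c0)).
    by rewrite !frobM barK -(frobC (m - k)) barK; char2_ring.
  rewrite -e2; last exact/eqP.
  by rewrite frobM barK (frobC m (m - k)) barK; char2_ring.
have nz_n0 : n0 != 0.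
  by apply: contraNneq nz_fn3 => n00; move/eqP: N0; rewrite n00 mulr0 mulf_eq0 (negPf nz_n3) orbF.
apply: (bar_expQ1_inj bn3 bn1 nz_n1).
have sq x : fr x = fr' x * fr' x.
  rewrite /frob -exprD; congr (_ ^+ _); lia.
rewrite !sq; apply: (mulIf nz_n0).
transitivity (fr' n3 * n3 * (fr' n3 * n0)); first by char2_ring.
by rewrite N0 N1; char2_ring.
Qed.
(* N(x) = T(x^q f(x)) is the square of a cubic form n over F_8 without zeros,
   hence n^7 = 1 on nonzero vectors; the constant coefficient of this identity
   contradicts sporadic_identity. *)
Lemma small_k_absurd : m = 3%N -> k = 2%N -> False.
Proof.
move=> m3 k2.
have eq_q : q = 8%N by rewrite m3.
have eQ : (2 ^ k)%N = 4%N by rewrite k2.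
have mk : (m - k)%N = 1%N by rewrite m3 k2.
have eQ' : (2 ^ (m - k))%N = 2%N by rewrite mk.
have [A eA] := frob_surj 1 (bar c3); have [B eB] := frob_surj 1 c1.
have [C eC] := frob_surj 1 c0.
have eA' : c3 = frob 1 (bar A) by rewrite frobC eA barK.
have e0 : A^+3 + (bar A)^+3 = B^+2 * bar C + (bar B)^+2 * C.
  have := @mu_coef 0%N [:: 0; 11]%N _ _ _ eq_q eQ eQ' isT erefl.
  rewrite /= !addr0 mk c2_conj -[c2]barK c2_conj -eA eA' -eB -eC => e.
  apply: eq_of_add0; apply: (@frob_inj 1); rewrite frob0 -[RHS]e.
  by rewrite -!(frobC 1 m) !frob_sqr; char2_ring.
have e1 : A^+2 * C = (bar B)^+2 * B.
  have := @mu_coef 1%N [:: 1]%N _ _ _ eq_q eQ eQ' isT erefl.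
  rewrite /= !addr0 mk -eA -eB -eC => e.
  apply: eq_of_add0; apply: (@frob_inj 1); rewrite frob0 -[RHS]e.
  by rewrite -!(frobC 1 m) !frob_sqr; char2_ring.
have e1' : (bar A)^+2 * bar C = B^+2 * bar B.
  by move/(congr1 bar): e1; rewrite !(barK, frobM, frobX).
have e4 : (bar B)^+2 * bar C + (bar A)^+2 * C + A^+2 * bar B + B^+2 * A = 0.
  have := @mu_coef 4%N [:: 2; 8]%N _ _ _ eq_q eQ eQ' isT erefl.
  rewrite /= !addr0 mk c2_conj -eA eA' -eB -eC => e.
  apply: (@frob_inj 1); rewrite frob0 -[RHS]e.
  by rewrite -!(frobC 1 m) !frob_sqr; char2_ring.
have nAB : A * bar A != B * bar B.
  apply: contra norms_neq => /eqP e; apply/eqP.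
  by rewrite -eA eA' -eB -(frobC 1 m) -!frobM -e mulrC.
have t0 : A * B^+6 + bar A * (bar B)^+6 + A^+4 * (bar B)^+3 + (bar A)^+4 * B^+3 = 0.
  have [B0 | nzB] := eqVneq B 0.
    by rewrite B0 frob0 !expr0n /= !mulr0 !addr0.
  have nzB' : bar B != 0 by rewrite frob_eq0.
  have nzA : A != 0.
    apply: contraNneq nzB => A0; move/esym/eqP: e1.
    by rewrite A0 expr0n /= mul0r mulf_eq0 expf_eq0 /= frob_eq0 orbb.
  have nzA' : bar A != 0 by rewrite frob_eq0.
  apply: (sporadic_identity nAB nzA nzA' nzB nzB' e1 e1' _ e4 e0).
  by move/(congr1 bar): e4; rewrite !(barK, frobD, frobM, frobX) frob0.
pose n x := A * x^+3 + B * (x^+2 * bar x) + bar B * (x * (bar x)^+2) + bar A * (bar x)^+3.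
have bn x : bar (n x) = n x.
  by rewrite /n !(barK, frobD, frobM, frobX); char2_ring.
have nz_n x : x != 0 -> n x != 0.
  move=> nz_x; have := quadF_trace nz_x; apply: contra => /eqP nx0.
  rewrite trace_radP /radP c2_conj (addrr_pchar2 charF) -eA -eB.
  have -> : fr x = x ^+ 4 by rewrite k2.
  rewrite !frob_sqr mul0r addr0 !(barK, frobD, frobM, frobX).
  apply/eqP/(lin_eq (lin_mul (n x) nx0)); rewrite /n; char2_ring.
have n7 x : x != 0 -> (n x)^+7 = 1.
  move=> nz_x; apply: (mulfI (nz_n x nz_x)); rewrite mulr1 -exprS -[RHS]bn.
  by rewrite /frob m3.
(* As x^q = x^8, n(x) is x^3 times a cubic in z = x^7 with coefficients [g]. Splitting n^7 = n n^2
   n^4 gives the exponents i + 2j + 4l, and x^21 = z^3 adds 3. *)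
pose g := nth 0 [:: A; B; bar B; bar A].
pose ij := [seq (i, j) | i <- iota 0 4, j <- iota 0 4]%N.
pose es : seq nat := (0 :: [seq t.1 + 2 * t.2 + 4 * l + 3 | t <- ij, l <- iota 0 4])%N.
pose cs : seq F := 1 :: [seq g t.1 * (g t.2)^+2 * (g l)^+4 | t <- ij, l <- iota 0 4%N].
have /mu_sparse_eq0/(_ 0%N isT) : forall x, x != 0 ->
    \sum_(p <- zip cs es) p.1 * (x ^+ (q - 1)) ^+ p.2 = 0.
  move=> x nz_x; have := n7 x nz_x; rewrite eq_q subn1 /=.
  have -> : n x = x^+3 * (A + B * x^+7 + bar B * (x^+7)^+2 + bar A * (x^+7)^+3).
    have bx : bar x = x^+8 by rewrite /frob m3.
    by rewrite /n bx; char2_ring.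
  rewrite exprMn (exprAC x 3 7).
  move: (x ^+ 7) => z e.
  rewrite (sum_foldr_map (fun p => p.1 * z ^+ p.2)) /cs /es /ij /g /=.
  apply: (lin_eq (lin_mul 1 e)); char2_ring.
have hz : [seq e %% 9 == 0 | e <- es]%N
    = ltac:(let b := eval vm_compute in [seq e %% 9 == 0 | e <- es]%N in exact b) by [].
rewrite eq_q => /(etrans (esym (sum_zip_mask cs es (fun e => e %% 9 == 0)%N))).
rewrite hz /cs /ij /g /= addr0 => e.
(* The constant coefficient is 1 plus multiples of the relations [t0], [e1'], [e1] and [e0]. *)
have : (1 : F) = 0; last by apply/eqP/oner_neq0.
rewrite -e; apply/esym/(lin_eq (lin_add (lin_add (lin_mul 1 t0)
  (lin_mul (A^+2 * B^+2) e1')) (lin_add (lin_mul ((bar A)^+2 * (bar B)^+2) e1)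
  (lin_mul (A^+2 * (bar A)^+2) e0)))).
char2_ring.
Qed.

(** * Normal form for k = 1 *)

(** For al^2 = c3^q and be^2 = c1, the Q'-th powers turn into conjugates of al and be, so the
    relations at 2Q', 0 and 1 become polynomial. One divides by al or, if al = 0, by be + be^q,
    which is then nonzero because T(f(1)) is. *)
Lemma k1_coefs : k = 1%N -> exists al be, [/\ c0 = al * bar be, c1 = be * be,
  c3 = bar al * bar al & al * bar al = be * be + be * bar be + bar be * bar be].
Proof.
have [u [v [w [eQ eQ' eq_q [v_gt0 uv] cond]]]] := half_powers.
move=> k1; move: cond => [[_ u1 wv v1] | [k2 _ _ _]]; last by move: k2; rewrite k1.
have [al eal] := frob_surj 1 (bar c3); have [be ebe] := frob_surj 1 c1.
have ec3 : c3 = frob 1 (bar al) by rewrite frobC eal barK.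
have f1 x : fr' (frob 1 x) = bar x by rewrite -k1 frK'.
have h8 : bar be * (al * al) + al * c0 = 0.
  have e : fr' c1 * bar c3 + fr' c3 * c0 = 0.
    by rewrite -c2_conj; mu_coef_at (4 * v)%N [:: 8]%N eq_q eQ eQ'.
  by move: e; rewrite -eal -ebe ec3 !f1 barK frob_sqr.
have h0 : bar al * (al * al) + be * c0 + (bar be * c0 + al * (be * be)) = 0.
  have e : fr' (bar c3) * bar c3 + fr' (bar c1) * c0 + (fr' c1 * c0 + fr' c3 * c1) = 0.
    by rewrite -{1}c2_conj; mu_coef_at 0%N [:: 0; 9]%N eq_q eQ eQ'.
  move: e; rewrite -eal -ebe ec3 (frobC m 1) !f1 !barK !frob_sqr //.
have h1 : bar al * c0 + be * (be * be) + (bar be * (bar be * bar be) + al * bar c0) = 0.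
  have e : fr' (bar c3) * c0 + fr' (bar c1) * c1 + (fr' c1 * bar c1 + fr' c3 * bar c0) = 0.
    by mu_coef_at 1%N [:: 1; 10]%N eq_q eQ eQ'.
  by move: e; rewrite -eal -ebe ec3 !(frobC m 1) !f1 !barK !frob_sqr.
rewrite !frob_sqr in ebe ec3.
have ec2 : c2 = bar c0 by rewrite -c2_conj barK.
have [al0 | nz_al] := eqVneq al 0.
  have nz_tau : be + bar be != 0.
    apply/eqP => /eq_of_add0 b_be; have := quadF_trace (oner_neq0 F).
    rewrite /quadF ec3 ec2 -ebe al0 !frob1 !frob0 !mul0r !mul1r !mulr1.
    rewrite !(barK, frobD, frobM) -b_be frob0 => /negP; apply; apply/eqP; char2_ring.
  have c00 : c0 = 0.
    apply: (mulfI nz_tau); rewrite mulr0 -[RHS]h0 al0; char2_ring.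
  exists al, be; split=> //; first by rewrite al0 mul0r c00.
  rewrite al0 mul0r; apply/esym; apply: (mulfI nz_tau).
  by rewrite mulr0 -[RHS]h1 c00 frob0 al0; char2_ring.
have c0E : c0 = al * bar be.
  by apply: (mulfI nz_al); apply: (lin_eq (lin_mul 1 h8)); char2_ring.
exists al, be; split=> //.
by apply: (mulfI nz_al); apply: (lin_eq (lin_mul 1 h0)); rewrite c0E; char2_ring.
Qed.

(* f = S M with M linear and S(x) = T(x^q M x) quadratic. The last identity of
   k1_coefs says M^2 = tau M + tau^2, so F becomes a line over F_q[M] = F_{q^2}:
   L turns M into multiplication by tau w, and S, being the determinant of
   (x, M x), into a multiple of the norm. *)
Lemma k1_conjugate : k = 1%N -> odd m ->
  exists (L : F -> F) (gamma : {unit F}),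
  [/\ Fq_linear q L, bijective L, #[(gamma ^+ (q - 1))%g]%g = 3%N &
     forall x, val gamma * L (f x) = L x ^+ (q + 2)].
Proof.
move=> k1 m_odd; have [al [be [ec0 ec1 ec3 en]]] := k1_coefs k1.
have ec2 : c2 = bar al * be by rewrite -[c2]barK c2_conj ec0 frobM barK.
have [tau etau] : {tau | tau = be + bar be} by exists (be + bar be).
have btau : bar tau = tau by rewrite etau bar_trace.
pose M x := bar be * x + bar al * bar x.
pose S x := al * (x * x) + tau * (x * bar x) + bar al * (bar x * bar x).
have fSM x : f x = S x * M x.
  rewrite /quadF -[fr x]/(x ^+ (2 ^ k)) -[fr (bar x)]/(bar x ^+ (2 ^ k)) k1.
  rewrite ec0 ec1 ec2 ec3 /S /M etau.
  by apply: (lin_eq (lin_mul (x * x * bar x) en)); char2_ring.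
have nz_tau : tau != 0.
  apply/eqP => tau0.
  (* With y^2 = al and tau = 0, S(z) is the square of yz + (yz)^q, which vanishes when yz lies in
     F_q. *)
  have [y ey] := frob_surj 1 al.
  have [z ez nz_z] : exists2 z, y * z = bar (y * z) & z != 0.
    have [-> | nz_y] := eqVneq y 0.
      by exists 1; rewrite ?oner_neq0 // mul0r frob0.
    by exists y^-1; rewrite ?invr_eq0 // mulfV // frob1.
  have := quadF_neq0 nz_z; rewrite fSM mulf_eq0 negb_or => /andP[/negP nS _].
  apply: nS; apply/eqP; rewrite /S tau0 mul0r addr0 -ey.
  transitivity ((y * z) ^+ 2 + (bar (y * z)) ^+ 2); last by rewrite -ez; char2_ring.
  by rewrite frobM -(frobC 1 m) !frob_sqr; char2_ring.
have [w w0 be_w] : exists2 w, w * w + w + 1 = 0 & bar be * w + be * (w * w) != 0.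
  have [w w0] := cube_root_exists.
  have [e | ne] := eqVneq (bar be * w + be * (w * w)) 0; last by exists w.
  (* The values at the two cube roots w and w + 1 = w^2 add up to tau, so they are not both 0. *)
  exists (w + 1); first by rewrite -[RHS]w0; char2_ring.
  apply: contra nz_tau => /eqP e'.
  apply/eqP.
  apply: (lin_eq (lin_add (lin_mul 1 e) (lin_mul 1 e'))).
  rewrite etau; char2_ring.
have bw := cube_root_conj m_odd w0.
have w3 : w ^+ 3 = 1 by apply: (lin_eq (lin_mul (w + 1) w0)); char2_ring.
(* M^2 = tau M + tau^2 has the roots tau w and tau w^2; adding the second to M gives an L with L M =
   tau w L. *)
pose L x := M x + tau * (w * w) * x.
have LD x y : L (x + y) = L x + L y by rewrite /L /M frobD; char2_ring.
have LZ a x : bar a = a -> L (a * x) = a * L x.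
  by move=> ba; rewrite /L /M frobM ba; char2_ring.
have LM x : L (M x) = tau * w * L x.
  rewrite /L /M !(barK, frobD, frobM).
  apply: (lin_eq (lin_add (lin_mul x en)
    (lin_mul (tau * (bar be * x + bar al * bar x) + tau * tau * x * (w + 1)) w0))).
  rewrite etau; char2_ring.
have [d ed] : {d | d = tau * (bar be * w + be * (w * w))}.
  by exists (tau * (bar be * w + be * (w * w))).
have nz_d : d != 0 by rewrite ed mulf_neq0.
have bd : bar d = d.
  rewrite ed !(barK, frobM m, frobD m) btau bw.
  by apply: (lin_eq (lin_mul (tau * bar be * w * (w + 1)) w0)); char2_ring.
have NL x : tau * (L x * bar (L x)) = d * S x.
  have bww : bar (w * w) = w.
    by rewrite frobM bw; apply: (lin_eq (lin_mul (w * (w + 1)) w0)); char2_ring.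
  rewrite /L /M /S !(frobD m) !(frobM m (bar _)) (frobM m (tau * _)) (frobM m tau).
  rewrite !barK btau bww.
  apply: (lin_eq (lin_add (lin_mul (tau * x * bar x) en)
    (lin_mul (tau * (al * bar be * x * x + bar al * be * bar x * bar x
        + tau * tau * (w + 1) * x * bar x)) w0))).
  rewrite ed etau; char2_ring.
have Lf x : d * L (f x) = tau * tau * w * (L x * (L x * bar (L x))).
  have bS : bar (S x) = S x.
    by rewrite /S !(barK, frobD m, frobM m) btau; char2_ring.
  rewrite fSM LZ // LM.
  transitivity (tau * w * L x * (d * S x)); first by char2_ring.
  by rewrite -NL; char2_ring.
have nz_S x : x != 0 -> S x != 0.
  by move/quadF_neq0; rewrite fSM mulf_eq0 negb_or => /andP[].
have L_inj : injective L.
  move=> x y /add0_of_eq; rewrite -LD => e; apply: eq_of_add0; apply/eqP.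
  apply: contraTT isT => /nz_S; rewrite -(mulrI_eq0 _ (mulfI nz_d)) -NL e.
  by rewrite mul0r mulr0 eqxx.
have nz_w : w != 0 by apply: contra_eq_neq w3 => ->; rewrite expr0n eq_sym oner_neq0.
(* The multiplier gamma is read off from [Lf]. As d and tau lie in F_q, gamma^(q-1) = w^(1-q) =
   w^2. *)
have nz_g : d / (tau * tau * w) != 0.
  by rewrite mulf_neq0 // invr_neq0 // !mulf_neq0.
have Ug : d / (tau * tau * w) \is a GRing.unit by rewrite unitfE.
have gq : (d / (tau * tau * w)) ^+ (q - 1) = w * w.
  apply: (mulfI nz_g); rewrite -exprS subn1 prednK ?expn_gt0 //.
  rewrite -[LHS]/(bar _) frobM frobV !frobM.
  rewrite btau bw bd [RHS]mulrAC; apply/eqP; rewrite eqr_div ?mulf_neq0 //; apply/eqP.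
  by apply: (lin_eq (lin_mul (d * tau * tau * w) w3)); char2_ring.
exists L, (FinRing.unit F Ug); split.
- by move=> a; rewrite inE => /eqP ba x y; rewrite LD LZ.
- exact: injF_bij.
- apply: nt_prime_order => //.
    apply: val_inj; rewrite !FinRing.val_unitX /= gq.
    by apply: (lin_eq (lin_mul (w ^+ 3 + 1) w3)); char2_ring.
  apply/negP => /eqP /(congr1 val); rewrite FinRing.val_unitX /= gq => w2.
  move/eqP: w0; rewrite w2 (addrAC 1) (addrr_pchar2 charF) add0r; exact/negP.
move=> x /=; rewrite mulrAC Lf exprD -[_ ^+ q]/(bar _) expr2.
apply: (mulIf (mulf_neq0 (mulf_neq0 nz_tau nz_tau) nz_w)).
by rewrite divfK ?mulf_neq0 //; char2_ring.
Qed.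
End Complete.

(** * The model x^(q+2) *)

(** For m odd, F_q contains no primitive cube root of unity. *)
Lemma cube_inj a b : odd m -> bar a = a -> bar b = b -> a ^+ 3 = b ^+ 3 -> a = b.
Proof.
move=> m_odd ba bb e; have [b0 | nz_b] := eqVneq b 0.
  by apply/eqP; move/eqP: e; rewrite b0 expr0n /= expf_eq0.
apply/eq_of_add0/eqP/negP => /negP nz_ab.
have w0 : (a / b) * (a / b) + a / b + 1 = 0.
  apply: (mulfI (mulf_neq0 nz_ab (mulf_neq0 nz_b nz_b))); rewrite mulr0.
  rewrite -{1}(divfK nz_b a); move: e; rewrite -{1}(divfK nz_b a); move: (a / b) => w e.
  by apply: (lin_eq (lin_mul 1 e)); char2_ring.
have /eqP := cube_root_conj m_odd w0; rewrite frobM frobV ba bb => /eqP e1.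
by move: w0; rewrite -e1 (addrr_pchar2 charF) add0r => /eqP; rewrite oner_eq0.
Qed.

Lemma expr_q2 x : x ^+ (q + 2) = (x * bar x) * x.
Proof. by rewrite exprD -[x ^+ q]/(bar x) expr2; char2_ring. Qed.

(** The norm of x^(q+2) is the cube of the norm of x, so the value determines the norm of x and then
    x. *)
Lemma expr_q2_inj : odd m -> injective (fun x : F => x ^+ (q + 2)).
Proof.
move=> m_odd x y; rewrite !expr_q2 => e.
have N : x * bar x = y * bar y.
  apply: cube_inj; rewrite ?bar_norm //.
  transitivity ((x * bar x * x) * bar (x * bar x * x)).
    by rewrite (frobM _ _ x) bar_norm; char2_ring.
  by rewrite e (frobM _ _ y) bar_norm; char2_ring.
have [y0 | nz_y] := eqVneq y 0.
  by apply/eqP; rewrite y0 -norm_eq0 N y0 mul0r.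
by move: e; rewrite N => /mulfI; apply; rewrite norm_eq0.
Qed.

(** With w = gamma^(q-1), c = gamma w^2 lies in F_q. If x has norm n, the value (n + gamma) x has
    norm (n + c)^3 + c^3, which determines n; the factor n + gamma is nonzero as gamma is outside
    F_q. *)
Lemma expr_q2D_inj (g : {unit F}) : odd m -> #[(g ^+ (q - 1))%g]%g = 3%N ->
  injective (fun x : F => x ^+ (q + 2) + val g * x).
Proof.
move=> m_odd og x y; rewrite !expr_q2 -!mulrDl => e.
set w := val (g ^+ (q - 1))%g.
have w3 : w ^+ 3 = 1 by rewrite -FinRing.val_unitX -og expg_order.
have w1 : w + 1 != 0.
  apply/eqP => /eq_of_add0 w1; have : (g ^+ (q - 1))%g = 1%g by apply: val_inj.
  by move=> eg; move: og; rewrite eg order1.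
have w0 : w * w + w + 1 = 0.
  by apply: (mulfI w1); rewrite mulr0; apply: (lin_eq (lin_mul 1 w3)); char2_ring.
have bw := cube_root_conj m_odd w0.
have bg : bar (val g) = w * val g.
  by rewrite /w FinRing.val_unitX -exprSr subn1 prednK // expn_gt0.
pose c := val g * (w * w).
have bc : bar c = c.
  rewrite /c !frobM bg bw.
  by apply: (lin_eq (lin_mul (val g * (w * w)) w3)); char2_ring.
have nz_g : val g != 0 by rewrite -unitfE (valP g).
have nz n : bar n = n -> n + val g != 0.
  move=> bn; apply/eqP => /eq_of_add0 en; move: bg; rewrite -en bn => ew.
  move/eqP: w1; apply; apply: (mulIf nz_g); rewrite mul0r mulrDl mul1r -en -ew.
  by rewrite (addrr_pchar2 charF).
have N : x * bar x = y * bar y.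
  have E z : (z * bar z + c) ^+ 3
      = ((z * bar z + val g) * z) * bar ((z * bar z + val g) * z) + c ^+ 3.
    rewrite (frobM _ _ z) frobD bar_norm bg /c.
    move: (val g) (bar z) => g' z'.
    apply: (lin_eq (lin_mul (z * z' * (z * z' * g' + g' * g' * w * (w + 1))) w0)).
    char2_ring.
  have {}e : (x * bar x + c) ^+ 3 = (y * bar y + c) ^+ 3 by rewrite !E e.
  by apply: (addIr c); apply: (cube_inj m_odd _ _ e); rewrite frobD bar_norm bc.
move: e; rewrite N => /mulfI; apply; apply: nz; exact: bar_norm.
Qed.
End Char2.

(** * From injectivity statements to the classification *)

Lemma perm_polyP (F : finFieldType) (p : {poly F}) :
  perm_poly p <-> injective (fun a => p.[a]).
Proof. by split=> [/bij_inj | /injF_bij]. Qed.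

Theorem theorem1p1 (m k : nat) (hk : (1 <= k <= m.-1)%N)
    (hodd : odd (m %/ gcdn m k)) (F : finFieldType)
    (hF : #|F| = ((2 ^ m) ^ 2)%N) (c0 c1 c2 c3 : F) :
  let q := (2 ^ m)%N in
  let Q := (2 ^ k)%N in
  let f := quad_poly q Q c0 c1 c2 c3 in
  let C := fun x : F => x ^+ (q + 2) in
  ((1 < k)%N -> ~ complete_perm_poly f) /\
  (k = 1%N ->
    (complete_perm_poly f <->
     odd m /\
     exists (L1 L2 : F -> F) (gamma : {unit F}),
       [/\ Fq_linear q L1 /\ bijective L1,
           Fq_linear q L2 /\ bijective L2,
           #[(gamma ^+ (q - 1))%g]%g = 3%N,
           forall x : F, f.[x] = L1 (C (L2 x))
         & forall x : F, f.[x] + x = L1 (C (L2 x) + val gamma * L2 x)])).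
Proof.
move=> q Q f C.
have charF : 2 \in [pchar F] by apply: (@card_finPcharP _ 2 (m * 2)); rewrite // hF -expnM.
have km : (0 < k < m)%N by lia.
have k_neq : k != (m - k)%N.
  apply: contraTN hodd => /eqP e.
  have -> : m = (2 * k)%N by lia.
  by rewrite gcdnC gcdnMl mulnK //; lia.
have fE x : f.[x] = quadF m k c0 c1 c2 c3 x by exact: horner_quad_poly.
have cppE : complete_perm_poly f ->
    injective (quadF m k c0 c1 c2 c3) /\ injective (fun x => quadF m k c0 c1 c2 c3 x + x).
  case=> /perm_polyP i1 /perm_polyP i2; split=> x y.
    by rewrite -!fE => /i1.
  by rewrite -!fE => e; apply: i2; rewrite !(hornerD f 'X) !hornerX.
split=> [k1 /cppE[i1 i2] | k1].
  have [m3 | m3] := ltnP 3 m; first exact: (large_k_absurd charF hF km i1 i2 k_neq k1 m3).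
  by apply: (small_k_absurd charF hF km i1 i2 k_neq); lia.
have m_odd : odd m by move: hodd; rewrite k1 gcdn1 divn1.
split=> [/cppE[i1 i2] | [_ [L1 [L2 [g [[_ bL1] [_ bL2] og e1 e2]]]]]].
  split=> //.
  have [L [g [linL bijL og Lf]]] := k1_conjugate charF hF km i1 i2 k_neq k1 m_odd.
  have [L' LK L'K] := bijL.
  have nz_g : val g != 0 by rewrite -unitfE (valP g).
  (* From gamma L(f(x)) = C(L(x)), taking L1 = L^-1 after division by gamma gives both identities,
     since L1(gamma L(x)) = x. *)
  exists (fun y => L' ((val g)^-1 * y)), L, g; split=> //.
  - split; last first.
      exists (fun x => val g * L x) => x; first by rewrite L'K mulVKf.
      by rewrite mulKf.
    move=> a qa x y; apply: (can_inj LK); rewrite L'K linL // !L'K.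
    by rewrite mulrDr mulrCA.
  - by move=> x; rewrite fE /C -Lf mulKf // LK.
  move=> x; rewrite fE /C -Lf -mulrDr mulKf //.
  by have := linL 1 _ (quadF m k c0 c1 c2 c3 x) x; rewrite !mul1r => <-; rewrite ?LK // inE expr1n.
split; apply/perm_polyP.
  move=> x y; rewrite !e1 => /(bij_inj bL1)/(expr_q2_inj charF hF m_odd).
  exact: (bij_inj bL2).
move=> x y; rewrite !(hornerD f 'X) !hornerX !e2.
by move/(bij_inj bL1)/(expr_q2D_inj charF hF m_odd og)/(bij_inj bL2).
Qed.
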